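(* Let $(X,d)$ be a locally connected metric space, $f:X\to X$ a continuous map, $n,l\in\mathbb{N}$ with $n,l\geq 2$, $\beta=(m_1,m_2,\dots,m_n)\in\mathbb{N}^n$ and $\alpha=(c_1,c_2,\dots,c_l)\in\mathbb{N}^l$. Let $B=\{m_1,\dots,m_n\}$ and $K=\{c_1,\dots,c_l\}=\{p_1,p_2,\dots,p_r\}$, where $p_i\neq p_j$ for $i\neq j$, and let $\gamma=(p_1,p_2,\dots,p_r,p_1,p_2,\dots,p_r)\in\mathbb{N}^{2r}$. Suppose that $B\subset K$ (inclusion, equality allowed). If $(X,f)$ is $\gamma$-$2r$-sensitive, then $(X,f)$ is $\beta$-$n$-sensitive.
   Context: $\mathbb{N}=\{1,2,3,\dots\}$. For $q\geq 2$ and $\eta=(e_1,\dots,e_q)\in\mathbb{N}^q$, $(X,f)$ is $\eta$-$q$-sensitive if there is $\delta>0$ such that for every nonempty open $U\subseteq X$ there are $k\in\mathbb{N}$ and $x_1,\dots,x_q\in U$ with $\min_{1\leq i<j\leq q}d(f^{e_ik}(x_i),f^{e_jk}(x_j))>\delta$. *)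

(* Defs.v *)
From HB Require Import structures.
From mathcomp Require Import all_boot all_order all_algebra.
From mathcomp Require Import all_classical all_reals all_analysis.

Set Implicit Arguments.
Unset Strict Implicit.
Unset Printing Implicit Defensive.

Import Order.TTheory GRing.Theory Num.Theory.

Local Open Scope classical_set_scope.
Local Open Scope ring_scope.

Definition locally_connected (T : topologicalType) : Prop :=
  forall (x : T) (U : set T), nbhs x U ->
    exists V : set T, [/\ open V, connected V, V x & V `<=` U].

(* The inequality min_(i < j) d(f^(e_i k)(x_i), f^(e_j k)(x_j)) > delta is
   written as the family of inequalities over all pairs i < j. The notion is
   meant for 2 <= q and positive entries of e; the time k is also positive. *)
Definition sensitive (R : realType) (X : metricType R) (f : X -> X)
    (q : nat) (e : q.-tuple nat) : Prop :=
  exists2 delta : R, 0 < delta &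
    forall U : set X, open U -> U !=set0 ->
      exists (k : nat) (x : 'I_q -> X),
        [/\ (0 < k)%N,
            forall i, U (x i) &
            forall i j : 'I_q, (i < j)%N ->
              delta < mdist (iter (tnth e i * k) f (x i))
                            (iter (tnth e j * k) f (x j))].

(* Main.v *)
Require Import Defs.
From mathcomp Require Import all_boot all_order all_algebra.
From mathcomp Require Import all_classical all_reals all_analysis.
From mathcomp Require Import lra.

Import Order.TTheory GRing.Theory Num.Theory.
Import numFieldNormedType.Exports.

Local Open Scope classical_set_scope.
Local Open Scope ring_scope.

(** A connected open set V whose image under f^(p k) contains two points more
    than delta apart has, by the intermediate value theorem applied to the
    distance from one of them, image points at every distance in [0, delta]
    from it. Each of fewer than n given points is close to at most one of n
    such points at distances 0, delta/n, 2 delta/n, ..., so some point of the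
    image is far from all of them, and the points for beta are chosen greedily.
    The two copies of each p in gamma make every such image wide. *)

Lemma continuous_iter (T : topologicalType) (f : T -> T) (k : nat) :
  continuous f -> continuous (iter k f).
Proof.
move=> cf; elim: k => [|k IHk] x; first exact: cvg_id.
by apply: (@continuous_comp _ _ _ (iter k f) f); [exact: IHk | exact: cf].
Qed.

Section Metric.
Context {R : realType} {X : metricType R}.
Implicit Types x y z : X.

Lemma ler_dist_mdist x y z : `|mdist z x - mdist z y| <= mdist x y.
Proof.
have := metric_triangle z x y; have := metric_triangle z y x.
by rewrite (metric_sym y x) ler_norml => *; lra.
Qed.

Lemma continuous_mdist z : continuous (mdist z : X -> R).
Proof.
move=> x; apply/cvgrPdist_lt => e e0; near=> y.
apply: le_lt_trans (ler_dist_mdist _ _ _) _.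
have yx : ball x e y by near: y; exact: nbhsx_ballx.
by rewrite ballEmdist in yx.
Unshelve. all: by end_near. Qed.

End Metric.

(** Grid values are spaced [3 * e] apart, so no [u] lies within [e] of two of them. If every grid
    value had a close element of [s], the position of the first such element would inject [n]
    indices into [size s] positions. *)
Lemma pigeonhole_grid {R : realFieldType} (e : R) (s : seq R) (n : nat) :
    0 < e -> (size s < n)%N ->
  exists2 i : nat, (i < n)%N &
    forall u, u \in s -> e < `|i%:R * (3 * e) - u|.
Proof.
move=> e0 ltsn.
pose close (i : 'I_n) u := `|i%:R * (3 * e) - u| <= e.
have [/existsP[i /hasPn si]|/existsPn closeP] :=
    boolP [exists i, ~~ has (close i) s].
  by exists i => // u /si; rewrite -ltNge.
have {}closeP i : has (close i) s by apply/negPn/closeP.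
have find_lt i : (find (close i) s < size s)%N by rewrite -has_find.
suff /leq_card : injective (fun i => Ordinal (find_lt i)).
  by rewrite !card_ord leqNgt ltsn.
move=> i j [eq_ij]; apply: val_inj; apply/eqP; rewrite eqn_leq.
(* The two positions agree, so both bounds concern the same element of [s], and the grid values of
   [i] and [j] differ by at most [2 * e]. *)
have := nth_find 0 (closeP i); have := nth_find 0 (closeP j).
rewrite -eq_ij /close !ler_norml => /andP[j1 j2] /andP[i1 i2].
have step (a b : nat) : (a < b)%N -> 3 * e <= b%:R * (3 * e) - a%:R * (3 * e).
  move=> ltab; rewrite -mulrBl -natrB; last exact: ltnW.
  by apply: ler_peMl; [rewrite mulr_ge0 // ltW | rewrite ler1n subn_gt0].
by rewrite !(leqNgt i, leqNgt j); apply/andP; split; apply/negP => /step; lra.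
Qed.

Section FarPoints.
Context {T : topologicalType} {R : realType} {Y : metricType R}.
Variables (V : set T) (delta : R) (n : nat).
Hypotheses (V_conn : connected V) (delta_gt0 : 0 < delta).

(** Chosen so that [n] grid values of spacing [3 * e], starting at 0, fit below [delta]. *)
Let e : R := delta / n%:R / 3.

Lemma connected_far_point (h : T -> Y) (a b : T) (s : seq Y) :
    continuous h -> V a -> V b -> delta < mdist (h a) (h b) ->
    (size s < n)%N ->
  exists2 v, V v & forall y, y \in s -> e < mdist y (h v).
Proof.
move=> ch Va Vb dab ltsn.
have n0 : (0 : R) < n%:R by rewrite ltr0n (leq_ltn_trans _ ltsn).
have e0 : 0 < e by rewrite !divr_gt0.
have eE : 3 * e = delta / n%:R by rewrite /e mulrC divfK.
have cg : continuous (fun v => mdist (h a) (h v)).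
  move=> v; apply: (@continuous_comp _ _ _ h (mdist (h a))); first exact: ch.
  exact: continuous_mdist.
have /connected_intervalP itv :
    connected ((fun v => mdist (h a) (h v)) @` V).
  by apply: connected_continuous_connected => //; exact: continuous_subspaceT.
have [|i ltin far] := pigeonhole_grid e [seq mdist (h a) y | y <- s] n e0.
  by rewrite size_map.
have [v Vv vE] : ((fun v => mdist (h a) (h v)) @` V) (i%:R * (3 * e)).
  apply: (itv (mdist (h a) (h a)) (mdist (h a) (h b))).
  - by exists a.
  - by exists b.
  (* The grid value is [i * delta / n] with [i < n], hence between 0 and [delta]. *)
  rewrite mdistxx eE mulr_ge0 ?divr_ge0 ?(ltW delta_gt0) ?ler0n //=.
  apply: le_trans (ltW dab); rewrite mulrCA ger_pMr //.
  by rewrite ler_pdivrMr // mul1r ler_nat ltnW.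
(* Distance to [h a] is 1-Lipschitz, so separation of these real distances passes to the points of
   [Y]. *)
exists v => // y ys; apply: lt_le_trans (far _ (map_f _ ys)) _.
by rewrite -vE (metric_sym y); exact: ler_dist_mdist.
Qed.

Lemma connected_far_family (h : nat -> T -> Y) :
    (forall i, continuous (h i)) ->
    (forall i, (i < n)%N ->
       exists a b, [/\ V a, V b & delta < mdist (h i a) (h i b)]) ->
    V !=set0 ->
  exists x : nat -> T, (forall i, (i < n)%N -> V (x i)) /\
    forall i j, (i < j < n)%N -> e < mdist (h i (x i)) (h j (x j)).
Proof.
move=> ch wide [v0 Vv0].
(* Induction on the number [m] of points already chosen; [e] stays tied to the final count [n]. *)
suff: forall m, (m <= n)%N -> exists x : nat -> T,
    (forall i, (i < m)%N -> V (x i)) /\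
    forall i j, (i < j < m)%N -> e < mdist (h i (x i)) (h j (x j)).
  exact.
elim=> [_|m IHm ltmn].
  by exists (fun=> v0); split=> // i j; rewrite ltn0 andbF.
have [x [xV xfar]] := IHm (ltnW ltmn).
have [a [b [Va Vb dab]]] := wide m ltmn.
have [|v Vv vfar] := @connected_far_point (h m) a b
  [seq h i (x i) | i <- iota 0 m] (ch m) Va Vb dab.
  by rewrite size_map size_iota.
exists (fun i => if i == m then v else x i); split=> [i|i j /andP[ltij]].
  by case: eqP => // /eqP neq_im; rewrite ltnS leq_eqVlt (negPf neq_im) => /xV.
rewrite ltnS leq_eqVlt; case: eqP => [eq_jm _|_ /= ltjm]; last first.
  by rewrite (ltn_eqF (ltn_trans ltij ltjm)) xfar // ltij.
rewrite eq_jm in ltij *; rewrite (ltn_eqF ltij); apply: vfar; apply: map_f.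
by rewrite mem_iota add0n ltij.
Qed.

End FarPoints.

Theorem theorem4 (R : realType) (X : metricType R) (f : X -> X)
    (n l r : nat)
    (beta : n.-tuple nat) (alpha : l.-tuple nat)
    (p : r.-tuple nat) (gamma : (2 * r).-tuple nat)
    (X_lc : locally_connected X) (f_cont : continuous f)
    (n_ge2 : (2 <= n)%N) (l_ge2 : (2 <= l)%N)
    (beta_gt0 : forall i, (0 < tnth beta i)%N)
    (alpha_gt0 : forall i, (0 < tnth alpha i)%N)
    (p_uniq : uniq p) (p_alpha : p =i alpha)
    (gammaE : tval gamma = tval p ++ tval p)
    (beta_sub_alpha : {subset beta <= alpha}) :
  sensitive f gamma -> sensitive f beta.
Proof.
move=> [delta delta0 sens]; have n0 : (0 < n)%N by exact: ltnW.
exists (delta / n%:R / 3) => [|U oU [u Uu]].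
  by rewrite !divr_gt0 // ltr0n.
(* Sensitivity is applied to a connected [V] inside [U], which yields one time [k] for all entries
   of [beta]. *)
have [V [oV cV Vu VU]] := X_lc u U (open_nbhs_nbhs (conj oU Uu)).
have [k [x [k0 xV xfar]]] := sens V oV (ex_intro _ u Vu).
(* The entry of [beta] sits in [p] at some index [t], hence in [gamma] at [t] and at [r + t]; the
   points of [x] at these two places are the witnesses. *)
have wide i : (i < n)%N -> exists a b, [/\ V a, V b &
    delta < mdist (iter (nth 0 beta i * k) f a)
                  (iter (nth 0 beta i * k) f b)].
  move=> ltin; have bp : nth 0 beta i \in tval p.
    by rewrite p_alpha beta_sub_alpha // mem_nth // size_tuple.
  have ltr : (index (nth 0 beta i) p < r)%N.
    by rewrite -{2}(size_tuple p) index_mem.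
  have lt1 : (index (nth 0 beta i) p < 2 * r)%N.
    by rewrite (leq_trans ltr) // leq_pmull.
  have lt2 : (r + index (nth 0 beta i) p < 2 * r)%N.
    by rewrite mul2n -addnn ltn_add2l.
  exists (x (Ordinal lt1)), (x (Ordinal lt2)); split; [exact: xV..|].
  have /= := xfar (Ordinal lt1) (Ordinal lt2).
  rewrite !(tnth_nth 0%N) /= gammaE !nth_cat size_tuple ltr.
  rewrite [(r + _ < r)%N]ltnNge leq_addr /= addKn nth_index //; apply.
  by rewrite ltn_addr.
have [y [yV yfar]] := connected_far_family V delta n cV delta0
  (fun i => iter (nth 0%N beta i * k) f)
  (fun i => continuous_iter _ _ _ f_cont) wide (ex_intro _ u Vu).
exists k, (fun i => y i); split=> // [i|i j ltij]; first exact/VU/yV.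
by rewrite !(tnth_nth 0%N) yfar // ltij /=.
Qed.
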